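(* There exists a universal semi-POVM $M$ such that $[M(s),M(t)]=M(s)M(t)-M(t)M(s)\neq 0$ for all distinct $s,t\in\Sigma^*$ (here $N\ge 2$ so that non-commuting Hermitian matrices exist).
   Context: $N$ is a fixed positive integer; $\Sigma^*$ is the set of finite binary strings. $\mathrm{Her}(N)$ is the set of $N\times N$ Hermitian matrices and $\mathrm{Her}_Q(N)$ those with entries in $\{a+ib:a,b\in\mathbb{Q}\}$; $A\leqslant B$ means $B-A$ is positive semi-definite. A semi-POVM on $\Sigma^*$ is a map $R:\Sigma^*\to\mathrm{Her}(N)$ with $0\leqslant R(s)$ for all $s$ and $\sum_s R(s)\leqslant I$. A lower-computable semi-POVM is a semi-POVM $R$ for which there is a total recursive $f:\mathbb{N}\times\Sigma^*\to\mathrm{Her}_Q(N)$ with $\lim_{n}f(n,s)=R(s)$ and $f(n,s)\leqslant R(s)$ for all $n,s$. A universal semi-POVM is a lower-computable semi-POVM $M$ such that for every lower-computable semi-POVM $R$ there is $c>0$ with $c\,R(s)\leqslant M(s)$ for all $s\in\Sigma^*$. *)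

(* Defs.v *)
From HB Require Import structures.
From mathcomp Require Import all_boot all_order all_algebra.
From mathcomp Require Import complex.
From mathcomp Require Import all_classical all_reals topology normedtype sequences.

Set Implicit Arguments.
Unset Strict Implicit.
Unset Printing Implicit Defensive.

Import Order.TTheory GRing.Theory Num.Theory.
Import numFieldNormedType.Exports.

Inductive rcode : Type :=
| RZero : rcode
| RSucc : rcode
| RProj : nat -> rcode
| RComp : rcode -> list rcode -> rcode
| RPrec : rcode -> rcode -> rcode
| RMu   : rcode -> rcode.

Inductive reval : rcode -> seq nat -> nat -> Prop :=
| reval_zero xs : reval RZero xs 0
| reval_succ x xs : reval RSucc (x :: xs) x.+1
| reval_proj i xs : (i < size xs)%N -> reval (RProj i) xs (nth 0%N xs i)
| reval_comp f gs xs ys y :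
    revals gs xs ys -> reval f ys y -> reval (RComp f gs) xs y
| reval_prec0 f g xs y : reval f xs y -> reval (RPrec f g) (0%N :: xs) y
| reval_precS f g n xs r y :
    reval (RPrec f g) (n :: xs) r -> reval g (n :: r :: xs) y ->
    reval (RPrec f g) (n.+1 :: xs) y
| reval_mu f xs n :
    reval f (n :: xs) 0 ->
    (forall m, (m < n)%N -> exists k, reval f (m :: xs) k.+1) ->
    reval (RMu f) xs n
with revals : list rcode -> seq nat -> seq nat -> Prop :=
| revals_nil xs : revals nil xs [::]
| revals_cons g gs xs y ys :
    reval g xs y -> revals gs xs ys -> revals (g :: gs) xs (y :: ys).

(* A total function between countable types is (total) recursive if, through
   the canonical computable encodings [pickle] of MathComp's countTypes, it is
   computed by a mu-recursive function. *)
Definition total_recursive (A B : countType) (f : A -> B) : Prop :=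
  exists c : rcode, forall a : A, reval c [:: pickle a] (pickle (f a)).

Definition bstring := seq bool.

Local Open Scope ring_scope.

Section Matrices.
Variables (R : realType) (N : nat).
Local Notation C := R[i].

Definition hermitian (A : 'M[C]_N) : Prop := A \is hermsymmx.

Definition psd (A : 'M[C]_N) : Prop :=
  hermitian A /\
  forall v : 'rV[C]_N, 0 <= (v *m A *m (map_mx Num.conj v)^T) 0 0.

Definition loewner_le (A B : 'M[C]_N) : Prop := psd (B - A).

Definition herQ_val (q : 'M[rat]_N * 'M[rat]_N) : 'M[C]_N :=
  \matrix_(i, j) Complex (ratr (q.1 i j)) (ratr (q.2 i j)).

(* semi-POVM on Sigma^*: 0 <= R(s) for all s and sum_s R(s) <= I, the latter
   meaning (for a sum of PSD terms over a countable index set) that every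
   finite partial sum is <= I. *)
Definition semiPOVM (P : bstring -> 'M[C]_N) : Prop :=
  (forall s, loewner_le 0 (P s)) /\
  (forall l : seq bstring, uniq l -> loewner_le (\sum_(s <- l) P s) 1%:M).

Definition mx_cvg (A : nat -> 'M[C]_N) (L : 'M[C]_N) : Prop :=
  forall i j,
    ((fun n => @complex.Re R (A n i j)) @ \oo --> @complex.Re R (L i j))%classic /\
    ((fun n => @complex.Im R (A n i j)) @ \oo --> @complex.Im R (L i j))%classic.

Definition lower_computable_semiPOVM (P : bstring -> 'M[C]_N) : Prop :=
  semiPOVM P /\
  exists f : nat * bstring -> 'M[rat]_N * 'M[rat]_N,
    total_recursive f /\
    (forall n s, hermitian (herQ_val (f (n, s)))) /\
    (forall s, mx_cvg (fun n => herQ_val (f (n, s))) (P s)) /\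
    (forall n s, loewner_le (herQ_val (f (n, s))) (P s)).

Definition universal_semiPOVM (M : bstring -> 'M[C]_N) : Prop :=
  lower_computable_semiPOVM M /\
  forall P : bstring -> 'M[C]_N, lower_computable_semiPOVM P ->
    exists c : R, 0 < c /\
      forall s, loewner_le ((c%:C)%C *: P s) (M s).

End Matrices.

(* Main.v *)
(** If [m] is a universal lower semicomputable semimeasure on strings, then [m(s) I]
    is a universal semi-POVM: for a lower-computable semi-POVM [P] every diagonal
    entry [P(s)_ii] is a lower semicomputable semimeasure, and [P(s)] is at most [N]
    times its diagonal.  Adding computable dyadic matrices
    [2^-(s+3) (I + E01 + E10) + 2^-(2s+3) E00] keeps universality, and the commutator
    of two sums is that of the added matrices alone: it is nonzero because the ratio
    of the two coefficients, [2^s], determines [s].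

    The semimeasure [m] mixes all programs.  Program [e] may put mass [2^-(k+1)] on
    [s], once for each [k]; it is silenced when its total mass would exceed 1.  The
    program accepting exactly the pairs with [2^-k < P(s)_ii] puts on [s] a mass
    between [P(s)_ii / 4] and [P(s)_ii], so it is never silenced and [m] dominates
    it.  Programs run on an abstract machine whose step function is
    primitive recursive. *)

Require Import Defs.
From HB Require Import structures.
From mathcomp Require Import all_boot all_order all_algebra.
From mathcomp Require Import complex.
From mathcomp Require Import all_classical all_reals topology normedtype sequences.
From mathcomp Require Import zify ring lra.
Import Order.TTheory GRing.Theory Num.Theory.
Import numFieldNormedType.Exports.

Set Implicit Arguments.
Unset Strict Implicit.
Unset Printing Implicit Defensive.

(** * Recursive functions on lists of numbers *)

(** Only lists of length [n] matter, so [f] may read its arguments with [nth] and any default.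
    Substitution is then plain composition under the binder [xs]. *)
Definition rec (n : nat) (f : seq nat -> nat) : Prop :=
  exists c, forall xs, size xs = n -> reval c xs (f xs).

Definition rec1 (h : nat -> nat) := rec 1 (fun xs => h (nth 0 xs 0)).
Definition rec2 (h : nat -> nat -> nat) :=
  rec 2 (fun xs => h (nth 0 xs 0) (nth 0 xs 1)).
Definition rec3 (h : nat -> nat -> nat -> nat) :=
  rec 3 (fun xs => h (nth 0 xs 0) (nth 0 xs 1) (nth 0 xs 2)).
Definition rec4 (h : nat -> nat -> nat -> nat -> nat) :=
  rec 4 (fun xs => h (nth 0 xs 0) (nth 0 xs 1) (nth 0 xs 2) (nth 0 xs 3)).
Definition rec5 (h : nat -> nat -> nat -> nat -> nat -> nat) :=
  rec 5 (fun xs =>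
    h (nth 0 xs 0) (nth 0 xs 1) (nth 0 xs 2) (nth 0 xs 3) (nth 0 xs 4)).

Lemma rec_ext n f g : rec n f -> (forall xs, size xs = n -> f xs = g xs) -> rec n g.
Proof. by move=> [c Hc] fg; exists c => xs sz; rewrite -fg //; apply: Hc. Qed.

Lemma rec_nth n i : i < n -> rec n (fun xs => nth 0 xs i).
Proof. by move=> lt_in; exists (RProj i) => xs sz; constructor; rewrite sz. Qed.

Lemma rec_nth_behead n i : i.+1 < n -> rec n (fun xs => nth 0 (behead xs) i).
Proof. by move=> h; apply: rec_ext (rec_nth h) _ => xs _; rewrite nth_behead. Qed.

Lemma rec_nth_behead2 n i : i.+2 < n -> rec n (fun xs => nth 0 (behead (behead xs)) i).
Proof. by move=> h; apply: rec_ext (rec_nth h) _ => xs _; rewrite !nth_behead. Qed.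

Lemma rec_comp1 n h f : rec1 h -> rec n f -> rec n (fun xs => h (f xs)).
Proof.
move=> [c Hc] [d Hd]; exists (RComp c [:: d]) => xs sz.
apply: (@reval_comp _ _ _ [:: f xs]); last exact: (Hc [:: f xs]).
by do ?constructor; apply: Hd.
Qed.

Lemma rec_comp2 n h f g :
  rec2 h -> rec n f -> rec n g -> rec n (fun xs => h (f xs) (g xs)).
Proof.
move=> [c Hc] [d Hd] [e He]; exists (RComp c [:: d; e]) => xs sz.
apply: (@reval_comp _ _ _ [:: f xs; g xs]); last exact: (Hc [:: f xs; g xs]).
by do ?constructor; auto.
Qed.

Lemma rec_comp3 n h f1 f2 f3 : rec3 h -> rec n f1 -> rec n f2 -> rec n f3 ->
  rec n (fun xs => h (f1 xs) (f2 xs) (f3 xs)).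
Proof.
move=> [c Hc] [d1 H1] [d2 H2] [d3 H3]; exists (RComp c [:: d1; d2; d3]) => xs sz.
apply: (@reval_comp _ _ _ [:: f1 xs; f2 xs; f3 xs]).
  by do ?constructor; auto.
exact: (Hc [:: f1 xs; f2 xs; f3 xs]).
Qed.

Lemma rec_comp4 n h f1 f2 f3 f4 :
  rec4 h -> rec n f1 -> rec n f2 -> rec n f3 -> rec n f4 ->
  rec n (fun xs => h (f1 xs) (f2 xs) (f3 xs) (f4 xs)).
Proof.
move=> [c Hc] [d1 H1] [d2 H2] [d3 H3] [d4 H4].
exists (RComp c [:: d1; d2; d3; d4]) => xs sz.
apply: (@reval_comp _ _ _ [:: f1 xs; f2 xs; f3 xs; f4 xs]).
  by do ?constructor; auto.
exact: (Hc [:: f1 xs; f2 xs; f3 xs; f4 xs]).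
Qed.

Lemma rec_comp5 n h f1 f2 f3 f4 f5 :
  rec5 h -> rec n f1 -> rec n f2 -> rec n f3 -> rec n f4 -> rec n f5 ->
  rec n (fun xs => h (f1 xs) (f2 xs) (f3 xs) (f4 xs) (f5 xs)).
Proof.
move=> [c Hc] [d1 H1] [d2 H2] [d3 H3] [d4 H4] [d5 H5].
exists (RComp c [:: d1; d2; d3; d4; d5]) => xs sz.
apply: (@reval_comp _ _ _ [:: f1 xs; f2 xs; f3 xs; f4 xs; f5 xs]).
  by do ?constructor; auto.
exact: (Hc [:: f1 xs; f2 xs; f3 xs; f4 xs; f5 xs]).
Qed.

Lemma revals_projs i m xs : i + m = size xs ->
  revals (map RProj (iota i m)) xs (drop i xs).
Proof.
elim: m i => [|m IH] i sz /=.
  by rewrite drop_oversize ?sz; [constructor | lia].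
have lt_i : i < size xs by lia.
rewrite (drop_nth 0 lt_i); constructor; first by constructor.
by apply: IH; lia.
Qed.

(** [RPrec] recurses on its first argument, so its code is called on the bound [F xs] followed by
    projections that pass the parameters on. Its body sees counter, accumulator, parameters. *)
Lemma rec_iteri n F B G : rec n F -> rec n B ->
  rec n.+2 (fun ys => G (nth 0 ys 0) (nth 0 ys 1) (behead (behead ys))) ->
  rec n (fun xs => iteri (F xs) (fun i r => G i r xs) (B xs)).
Proof.
move=> [cF HF] [cB HB] [cG HG].
exists (RComp (RPrec cB cG) (cF :: map RProj (iota 0 n))) => xs sz.
apply: (@reval_comp _ _ _ (F xs :: xs)).
  constructor; first exact: HF.
  by rewrite -{2}[xs]drop0; apply: revals_projs.
elim: (F xs) => [|m IH] /=; first by constructor; apply: HB.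
apply: reval_precS IH _.
by apply: (HG [:: m, _ & xs]); rewrite /= sz.
Qed.

Lemma rec0 n : rec n (fun=> 0).
Proof. by exists RZero => xs _; constructor. Qed.

Lemma rec_succ : rec1 succn.
Proof. by exists RSucc; case=> [|x []] //= _; constructor. Qed.

Lemma recS n f : rec n f -> rec n (fun xs => (f xs).+1).
Proof. exact: rec_comp1 rec_succ. Qed.

Lemma rec_const n k : rec n (fun=> k).
Proof. by elim: k => [|k IH]; [apply: rec0 | apply: recS]. Qed.

Ltac rec_var :=
  first [ by apply: rec_nth | by apply: rec_nth_behead | by apply: rec_nth_behead2 ].

Lemma rec_addn : rec2 addn.
Proof.
apply: (rec_ext (f := fun xs => iteri (nth 0 xs 0) (fun _ r => r.+1) (nth 0 xs 1))).
  by apply: (@rec_iteri 2 _ _ (fun _ r _ => r.+1)); do ?apply: recS; rec_var.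
by case=> [|x [|y []]] //= _; elim: x => //= x ->.
Qed.

Lemma recD n f g : rec n f -> rec n g -> rec n (fun xs => f xs + g xs).
Proof. exact: rec_comp2 rec_addn. Qed.

Lemma rec_muln : rec2 muln.
Proof.
apply: (rec_ext (f := fun xs => iteri (nth 0 xs 0) (fun _ r => nth 0 xs 1 + r) 0)).
  apply: (@rec_iteri 2 _ _ (fun _ r xs => nth 0 xs 1 + r)); first rec_var.
    exact: rec0.
  by apply: recD; rec_var.
by case=> [|x [|y []]] //= _; elim: x => //= x ->.
Qed.

Lemma recM n f g : rec n f -> rec n g -> rec n (fun xs => f xs * g xs).
Proof. exact: rec_comp2 rec_muln. Qed.

Lemma rec_exp2 : rec1 (expn 2).
Proof.
apply: (rec_ext (f := fun xs => iteri (nth 0 xs 0) (fun _ r => 2 * r) 1)).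
  apply: (@rec_iteri 1 _ _ (fun _ r xs => 2 * r)); first rec_var.
    exact: rec_const.
  by apply: recM; [apply: rec_const | rec_var].
by case=> [|x []] //= _; elim: x => //= x ->; rewrite expnS.
Qed.

Lemma recX2 n f : rec n f -> rec n (fun xs => 2 ^ f xs).
Proof. exact: rec_comp1 rec_exp2. Qed.

Lemma rec_pred : rec1 predn.
Proof.
apply: (rec_ext (f := fun xs => iteri (nth 0 xs 0) (fun i _ => i) 0)).
  by apply: (@rec_iteri 1 _ _ (fun i _ _ => i)); [rec_var | apply: rec0 | rec_var].
by case=> [|[|x] []].
Qed.

Lemma recP n f : rec n f -> rec n (fun xs => (f xs).-1).
Proof. exact: rec_comp1 rec_pred. Qed.

Lemma rec_subn : rec2 subn.
Proof.
apply: (rec_ext (f := fun xs => iteri (nth 0 xs 1) (fun _ r => r.-1) (nth 0 xs 0))).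
  by apply: (@rec_iteri 2 _ _ (fun _ r _ => r.-1)); do ?apply: recP; rec_var.
by case=> [|x [|y []]] //= _; elim: y => [|y IH] /=; [rewrite subn0 | rewrite IH subnS].
Qed.

Lemma recB n f g : rec n f -> rec n g -> rec n (fun xs => f xs - g xs).
Proof. exact: rec_comp2 rec_subn. Qed.

Lemma recleq n f g : rec n f -> rec n g -> rec n (fun xs => nat_of_bool (f xs <= g xs)).
Proof.
(* With truncated subtraction, 1 - (f - g) is 1 if f <= g and 0 otherwise. *)
move=> Hf Hg; apply: rec_ext (recB (rec_const n 1) (recB Hf Hg)) _ => xs _.
by case: leqP; lia.
Qed.

Lemma receq n f g : rec n f -> rec n g -> rec n (fun xs => nat_of_bool (f xs == g xs)).
Proof.
move=> Hf Hg; apply: rec_ext (recM (recleq Hf Hg) (recleq Hg Hf)) _ => xs _.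
by rewrite mulnb -eqn_leq.
Qed.

Lemma recand n (a b : seq nat -> bool) : rec n (fun xs => nat_of_bool (a xs)) ->
  rec n (fun xs => nat_of_bool (b xs)) -> rec n (fun xs => nat_of_bool (a xs && b xs)).
Proof. by move=> Ha Hb; apply: rec_ext (recM Ha Hb) _ => xs _; rewrite mulnb. Qed.

Lemma recif n (b : seq nat -> bool) f g : rec n (fun xs => nat_of_bool (b xs)) ->
  rec n f -> rec n g -> rec n (fun xs => if b xs then f xs else g xs).
Proof.
move=> Hb Hf Hg.
apply: rec_ext (recD (recM Hb Hf) (recM (recB (rec_const n 1) Hb) Hg)) _ => xs _.
by case: (b xs); rewrite ?mul1n ?mul0n ?addn0.
Qed.

Lemma recsum n F G : rec n F ->
  rec n.+1 (fun ys => G (nth 0 ys 0) (behead ys)) ->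
  rec n (fun xs => \sum_(i < F xs) G i xs).
Proof.
move=> HF HG.
apply: (rec_ext (f := fun xs => iteri (F xs) (fun i r => r + G i xs) 0)).
  apply: (@rec_iteri n _ _ (fun i r xs => r + G i xs)) => //; first exact: rec0.
  apply: recD; first by rec_var.
  case: HG => c Hc.
  (* The summand takes the counter and the parameters; the projections skip position 1, which holds
     the accumulator. *)
  exists (RComp c (RProj 0 :: map RProj (iota 2 n))) => xs sz.
  apply: (@reval_comp _ _ _ (nth 0 xs 0 :: drop 2 xs)).
    constructor; first by constructor; rewrite sz.
    by apply: revals_projs; rewrite sz; lia.
  have -> : behead (behead xs) = drop 2 xs by case: (xs) => [|? [|? ?]] //=; rewrite drop0.
  by apply: (Hc (nth 0 xs 0 :: drop 2 xs)); rewrite /= size_drop; lia.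
by move=> xs _; elim: (F xs) => [|m IH] /=; rewrite ?big_ord0 // big_ord_recr IH.
Qed.

Lemma sum_ltn x m : \sum_(i < x) (i < m : nat) = minn x m.
Proof. by elim: x => [|x IH]; rewrite ?big_ord0 ?big_ord_recr /= ?IH; lia. Qed.

(** The quotient counts the i < x with (i + 1) d <= x. The conjunct [0 < d] yields 0 for a zero
    divisor, in agreement with [divn0]. *)
Lemma recdiv n f g : rec n f -> rec n g -> rec n (fun xs => f xs %/ g xs).
Proof.
move=> Hf Hg.
suff H : rec2 (fun x d => \sum_(i < x) ((0 < d) && (i.+1 * d <= x) : nat)).
  apply: rec_ext (rec_comp2 H Hf Hg) _ => xs _.
  set x := f xs; set d := g xs; case: (posnP d) => [->|d0].
    by rewrite divn0 big1.
  rewrite (eq_bigr (fun i : 'I_x => (i < x %/ d : nat))); last first.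
    by move=> i _; rewrite leq_divRL // d0.
  by rewrite sum_ltn; apply/minn_idPr; apply: leq_div.
apply: (@recsum 2 _ (fun i xs => (0 < nth 0 xs 1) && (i.+1 * nth 0 xs 1 <= nth 0 xs 0))).
  by rec_var.
apply: recand; apply: recleq; try apply: recM; try apply: recS; rewrite /=.
all: by [apply: rec0 | rec_var].
Qed.

Lemma recdvd n f g : rec n f -> rec n g -> rec n (fun xs => nat_of_bool (f xs %| g xs)).
Proof.
move=> Hf Hg; apply: rec_ext (receq (recM (recdiv Hg Hf) Hf) Hg) _ => xs _.
by rewrite dvdn_eq.
Qed.

(** * Pairing and lists as numbers *)

(* [cns] is the [cons] of [CodeSeq.code], the list coding behind [pickle]. *)
Definition cns a b := 2 ^ a * b.*2.+1.
(** Both are total: 0, the code of the empty list, has head and tail 0, so reading past the end of a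
    list gives 0. *)
Definition hd x := logn 2 x.
Definition tl x := x %/ 2 ^ (logn 2 x).+1.

Lemma code_cons x l : CodeSeq.code (x :: l) = cns x (CodeSeq.code l).
Proof. by []. Qed.

Lemma hd0 : hd 0 = 0. Proof. by []. Qed.
Lemma tl0 : tl 0 = 0. Proof. by []. Qed.

Lemma hd_cns a b : hd (cns a b) = a.
Proof.
rewrite /hd /cns lognM ?expn_gt0 // pfactorK // lognE /=.
by rewrite dvdn2 /= odd_double /= addn0.
Qed.

Lemma tl_cns a b : tl (cns a b) = b.
Proof.
rewrite /tl -/(hd _) hd_cns /cns expnSr divnMA mulKn ?expn_gt0 //.
by rewrite divn2 /= uphalf_double.
Qed.

Lemma cns_gt0 a b : 0 < cns a b.
Proof. by rewrite muln_gt0 expn_gt0. Qed.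

Lemma cns_eq0 a b : (cns a b == 0) = false.
Proof. by apply/eqP; have := cns_gt0 a b; lia. Qed.

Lemma reccns n f g : rec n f -> rec n g -> rec n (fun xs => cns (f xs) (g xs)).
Proof.
move=> Hf Hg; apply: rec_ext (recM (recX2 Hf) (recS (recD Hg Hg))) _ => xs _.
by rewrite /cns addnn.
Qed.

(** The 2-adic valuation of x counts the i with 2^(i+1) dividing x, and all of them lie below x when
    x > 0. *)
Lemma rec_hd : rec1 hd.
Proof.
apply: (rec_ext (f := fun xs => \sum_(i < nth 0 xs 0) (2 ^ i.+1 %| nth 0 xs 0))).
  apply: (@recsum 1 _ (fun i xs => 2 ^ i.+1 %| nth 0 xs 0)); first by rec_var.
  by apply: recdvd; [apply: recX2; apply: recS | ]; rec_var.
move=> xs _; set x := nth 0 xs 0; case: (posnP x) => [->|x0].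
  by rewrite big_ord0.
rewrite (eq_bigr (fun i : 'I_x => (i < hd x : nat))); last first.
  by move=> i _; rewrite pfactor_dvdn.
rewrite sum_ltn; apply/minn_idPr/ltnW.
by apply: (leq_trans (ltn_expl _ (isT : 1 < 2))); rewrite dvdn_leq // pfactor_dvdnn.
Qed.

Lemma rechd n f : rec n f -> rec n (fun xs => hd (f xs)).
Proof. exact: rec_comp1 rec_hd. Qed.

Lemma rectl n f : rec n f -> rec n (fun xs => tl (f xs)).
Proof. by move=> Hf; apply: recdiv Hf (recX2 (recS (rechd Hf))). Qed.

Lemma reciter n h F B : rec1 h -> rec n F -> rec n B ->
  rec n (fun xs => iter (F xs) h (B xs)).
Proof.
move=> Hh HF HB.
have H := @rec_iteri n F B (fun _ r _ => h r) HF HB.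
apply: rec_ext (H _) _; first by apply: rec_comp1 => //; rec_var.
by move=> xs _; elim: (F xs) => //= m ->.
Qed.

Ltac rec_auto := repeat
  lazymatch goal with
  | |- rec _ (fun xs => if _ then _ else _) => apply recif
  | |- rec _ (fun xs => nat_of_bool (_ && _)) => apply recand
  | |- rec _ (fun xs => nat_of_bool (_ == _)) => apply receq
  | |- rec _ (fun xs => nat_of_bool (_ <= _)) => apply recleq
  | |- rec _ (fun xs => cns _ _) => apply reccns
  | |- rec _ (fun xs => hd _) => apply rechd
  | |- rec _ (fun xs => tl _) => apply rectl
  | |- rec _ (fun xs => _.+1) => apply recS
  | |- rec _ (fun xs => _.-1) => apply recP
  | |- rec _ (fun xs => 2 ^ _) => apply recX2
  | |- rec _ (fun xs => _ + _) => apply recD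
  | |- rec _ (fun xs => _ - _) => apply recB
  | |- rec _ (fun xs => _ * _) => apply recM
  | |- rec _ (fun xs => nth _ _ _) => rec_var
  | |- rec _ (fun _ => ?k) => apply rec_const
  end.


(** * An abstract machine for mu-recursive codes *)

Fixpoint quote (c : rcode) : nat :=
  match c with
  | RZero => cns 0 0
  | RSucc => cns 1 0
  | RProj i => cns 2 i
  | RComp f gs =>
      cns 3 (cns (quote f)
        ((fix quotes gs := if gs is g :: gs' then cns 7 (cns (quote g) (quotes gs'))
                           else cns 6 0) gs))
  | RPrec f g => cns 4 (cns (quote f) (quote g))
  | RMu f => cns 5 (quote f)
  end.

(** A named copy of the local fixpoint of [quote], so that argument lists can be run by the machine
    and reasoned about on their own. *)
Fixpoint quotes gs :=
  if gs is g :: gs' then cns 7 (cns (quote g) (quotes gs')) else cns 6 0.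

Lemma quote_comp f gs : quote (RComp f gs) = cns 3 (cns (quote f) (quotes gs)).
Proof. by []. Qed.

Definition st_eval c a K := cns 0 (cns c (cns a K)).
Definition st_ret v K := cns 1 (cns v K).

(* [c] is a quoted code (with tags 6 and 7 for lists of codes), [a] the coded
   list of arguments, [K] the coded stack of pending frames. *)
Definition step_eval c a K :=
  let t := hd c in let b := tl c in
  if t == 0 then st_ret 0 K else
  if t == 1 then st_ret (hd a).+1 K else
  if t == 2 then
    if b == 0 then st_ret (hd a) K else st_eval (cns 2 b.-1) (tl a) K else
  if t == 3 then st_eval (tl b) a (cns (cns 0 (hd b)) K) else
  if t == 4 then
    if hd a == 0 then st_eval (hd b) (tl a) K
    else st_eval c (cns (hd a).-1 (tl a))
           (cns (cns 3 (cns (tl b) (cns (hd a).-1 (tl a)))) K) else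
  if t == 5 then st_eval b (cns 0 a) (cns (cns 4 (cns b (cns 0 a))) K) else
  if t == 6 then st_ret 0 K else
  st_eval (tl b) a (cns (cns 1 (cns (hd b) a)) K).

(** Frame tags: 0 applies the outer code of a composition to the computed arguments; 1 evaluates the
    head of an argument list once its tail is known, and 2 conses that head on; 3 applies the step
    of a recursion; 4, the final case, tests a value of a minimisation and goes on searching. With
    an empty stack the state is a fixed point, which represents halting. *)
Definition step_ret v K :=
  let t := hd (hd K) in let b := tl (hd K) in let K' := tl K in
  if K == 0 then st_ret v K else
  if t == 0 then st_eval b v K' else
  if t == 1 then st_eval (hd b) (tl b) (cns (cns 2 v) K') else
  if t == 2 then st_ret (cns v b) K' else
  if t == 3 then st_eval (hd b) (cns (hd (tl b)) (cns v (tl (tl b)))) K' else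
  if v == 0 then st_ret (hd (tl b)) K' else
  st_eval (hd b) (cns (hd (tl b)).+1 (tl (tl b)))
    (cns (cns 4 (cns (hd b) (cns (hd (tl b)).+1 (tl (tl b))))) K').

Definition step z :=
  let b := tl z in
  if hd z == 0 then step_eval (hd b) (hd (tl b)) (tl (tl b))
  else step_ret (hd b) (tl b).

Definition reaches z z' := exists t, iter t step z = z'.

Lemma reaches_refl z : reaches z z.
Proof. by exists 0. Qed.

Lemma reaches_trans z2 z1 z3 : reaches z1 z2 -> reaches z2 z3 -> reaches z1 z3.
Proof. by move=> [t <-] [u <-]; exists (u + t); rewrite iterD. Qed.

Lemma reaches_step z z' : reaches (step z) z' -> reaches z z'.
Proof. by move=> [t <-]; exists t.+1; rewrite iterSr. Qed.

Lemma step_evalE c a K : step (st_eval c a K) = step_eval c a K.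
Proof. by rewrite /step /st_eval !(hd_cns, tl_cns). Qed.

Lemma step_retE v K : step (st_ret v K) = step_ret v K.
Proof. by rewrite /step /st_ret !(hd_cns, tl_cns). Qed.

Lemma iter_step_final t v : iter t step (st_ret v 0) = st_ret v 0.
Proof. by elim: t => //= t ->; rewrite step_retE. Qed.

Local Notation code := CodeSeq.code.

Ltac go := apply: reaches_step;
  rewrite ?code_cons ?step_evalE ?step_retE /step_eval /step_ret ?quote_comp /=
    ?(hd_cns, tl_cns, cns_eq0, hd0, tl0) /=.

(** Quantifying over the stack makes the property usable for a subcode run beneath freshly pushed
    frames. *)
Definition computes c xs y :=
  forall K, reaches (st_eval c (code xs) K) (st_ret y K).

(** The machine drops one argument per decrement of the index; past the end it keeps reading 0, the
    default used by [nth]. *)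
Lemma computes_proj i xs : computes (quote (RProj i)) xs (nth 0 xs i).
Proof.
elim: i xs => [|i IH] xs K; go.
  by case: xs => [|x xs]; rewrite ?code_cons ?hd_cns; apply: reaches_refl.
rewrite -/(quote (RProj i)).
case: xs => [|x xs]; last by rewrite code_cons tl_cns; apply: IH.
by have := IH [::] K; rewrite nth_nil.
Qed.

Lemma computes_mu f xs n : computes (quote f) (n :: xs) 0 ->
  (forall m, m < n -> exists k, computes (quote f) (m :: xs) k.+1) ->
  computes (quote (RMu f)) xs n.
Proof.
move=> Hn Hlt K; go.
suff H m : m <= n -> reaches
    (st_eval (quote f) (cns m (code xs)) (cns (cns 4 (cns (quote f) (cns m (code xs)))) K))
    (st_ret n K) by apply: H.
(* Induction on the distance left to search: a nonzero value at m makes frame 4 restart the search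
   at m + 1. *)
move def_d : (n - m) => d; elim: d m def_d => [|d IH] m def_d le_mn.
  have -> : m = n by lia.
  by apply: reaches_trans (Hn _) _; go; apply: reaches_refl.
have [|k Hk] := Hlt m; first by lia.
by apply: reaches_trans (Hk _) _; go; apply: IH; lia.
Qed.

(** Recursion directly on derivations, because the derivations for smaller arguments of [RMu] sit
    under an existential and must also be accessible as recursive calls. *)
Fixpoint reval_computes c xs y (H : reval c xs y) {struct H} : computes (quote c) xs y
with revals_computes gs xs ys (H : revals gs xs ys) {struct H} :
  computes (quotes gs) xs (code ys).
Proof.
- case: H => {c xs y}.
  + by move=> xs K; go; apply: reaches_refl.
  + by move=> x xs K; go; apply: reaches_refl.
  + by move=> i xs _; apply: computes_proj.
  + move=> f gs xs ys y Hgs Hf K; go.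
    apply: reaches_trans (revals_computes _ _ _ Hgs _) _; go.
    exact: reval_computes Hf K.
  + move=> f g xs y Hf K; go; exact: reval_computes Hf K.
  + move=> f g n xs r y Hr Hg K; go.
    apply: reaches_trans (reval_computes _ _ _ Hr _) _; go.
    exact: reval_computes Hg K.
  + move=> f xs n Hn Hlt; apply: computes_mu; first exact: reval_computes Hn.
    move=> m /Hlt [k Hk]; exists k; exact: reval_computes Hk.
- case: H => {gs xs ys}.
  + by move=> xs K; go; apply: reaches_refl.
  + move=> g gs xs y ys Hg Hgs K; go.
    apply: reaches_trans (revals_computes _ _ _ Hgs _) _; go.
    apply: reaches_trans (reval_computes _ _ _ Hg _) _; go.
    exact: reaches_refl.
Qed.

Lemma rec_step : rec1 step.
Proof.
have He : rec3 step_eval by rewrite /rec3 /step_eval /st_ret /st_eval; rec_auto.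
have Hr : rec2 step_ret by rewrite /rec2 /step_ret /st_ret /st_eval; rec_auto.
apply: recif; first by rec_auto.
  by apply: rec_comp3 => //; rec_auto.
by apply: rec_comp2 => //; rec_auto.
Qed.

(** * A universal lower semicomputable semimeasure *)

(** Program [e] enumerates the pairs (k, s) for which some [n] is accepted: [n] is the existential
    witness and [t] the number of machine steps allowed. *)
Definition acc e k s n t :=
  iter t step (st_eval e (CodeSeq.code [:: k; s; n]) 0) == st_ret 1 0.

(** A bounded existential is written as a positive sum, so that [recsum] shows it recursive. *)
Definition inW e t k s := 0 < \sum_(n < t) acc e k s n t.

(** The total of the masses 2^-(k+1) requested by stage [t], multiplied by 2^t to stay an integer;
    [good] says that this total is at most 1. *)
Definition weight e t := \sum_(k < t) \sum_(s < t) inW e t k s * 2 ^ (t - k.+1).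

Definition good e t := weight e t <= 2 ^ t.

(* Program [e] has put mass 2^-(k+1) on [s] before stage [n], at a time [t] when
   the total mass it had distributed was still at most 1. *)
Definition ok e n k s :=
  0 < \sum_(t < n) ((k < t) && ((s < t) && (good e t && inW e t k s))).

(** The mixture of all programs, program [e] having weight 2^-(e+1), at stage [n] and multiplied by
    2^(2n). *)
Definition mass n s :=
  \sum_(e < n) \sum_(k < n) ok e n k s * 2 ^ ((n - e.+1) + (n - k.+1)).

(** * Recursiveness of the stages *)

Lemma rec_acc : rec5 (fun e k s n t => acc e k s n t : nat).
Proof.
apply: receq; last exact: rec_const.
apply: reciter; [exact: rec_step | by rec_auto | rewrite /st_eval].
by apply: (rec_ext (f := fun xs =>
  cns 0 (cns (nth 0 xs 0) (cns (cns (nth 0 xs 1) (cns (nth 0 xs 2)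
    (cns (nth 0 xs 3) 0))) 0)))); first rec_auto.
Qed.

Lemma rec_inW : rec4 (fun e t k s => inW e t k s : nat).
Proof.
apply: recleq; first exact: rec_const.
apply: (@recsum 4 _ (fun n xs =>
  acc (nth 0 xs 0) (nth 0 xs 2) (nth 0 xs 3) n (nth 0 xs 1))); first by rec_auto.
by apply: (rec_comp5 rec_acc); rec_auto.
Qed.

Lemma rec_weight : rec2 weight.
Proof.
apply: (@recsum 2 _ (fun k xs => \sum_(s < nth 0 xs 1)
  inW (nth 0 xs 0) (nth 0 xs 1) k s * 2 ^ (nth 0 xs 1 - k.+1))); first by rec_auto.
apply: (@recsum 3 _ (fun s ys =>
  inW (nth 0 (behead ys) 0) (nth 0 (behead ys) 1) (nth 0 ys 0) s
    * 2 ^ (nth 0 (behead ys) 1 - (nth 0 ys 0).+1))); first by rec_auto.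
apply: recM; last by rec_auto.
by apply: (rec_comp4 rec_inW); rec_auto.
Qed.

Lemma rec_ok : rec4 (fun e n k s => ok e n k s : nat).
Proof.
apply: recleq; first exact: rec_const.
apply: (@recsum 4 _ (fun t xs => (nth 0 xs 2 < t) && ((nth 0 xs 3 < t) &&
  (good (nth 0 xs 0) t && inW (nth 0 xs 0) t (nth 0 xs 2) (nth 0 xs 3)))));
  first by rec_auto.
do 2 (apply: recand; first by rec_auto).
apply: recand; last by apply: (rec_comp4 rec_inW); rec_auto.
by apply: recleq; [apply: (rec_comp2 rec_weight) |]; rec_auto.
Qed.

Lemma rec_mass : rec2 mass.
Proof.
apply: (@recsum 2 _ (fun e xs => \sum_(k < nth 0 xs 0) ok e (nth 0 xs 0) k (nth 0 xs 1)
  * 2 ^ ((nth 0 xs 0 - e.+1) + (nth 0 xs 0 - k.+1)))); first by rec_auto.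
apply: (@recsum 3 _ (fun k ys =>
  ok (nth 0 ys 0) (nth 0 (behead ys) 0) k (nth 0 (behead ys) 1)
  * 2 ^ ((nth 0 (behead ys) 0 - (nth 0 ys 0).+1) + (nth 0 (behead ys) 0 - k.+1))));
  first by rec_auto.
apply: recM; last by rec_auto.
by apply: (rec_comp4 rec_ok); rec_auto.
Qed.

Lemma sum_bool_gt0 n (P : nat -> bool) :
  reflect (exists2 i, i < n & P i) (0 < \sum_(i < n) P i).
Proof.
rewrite lt0n sum_nat_eq0 negb_forall; apply: (iffP existsP) => [[j]|[j lt_jn Pj]].
  by rewrite /= eqb0 negbK; exists j.
by exists (Ordinal lt_jn); rewrite /= Pj.
Qed.

Lemma acc_mono e k s n t u : t <= u -> acc e k s n t -> acc e k s n u.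
Proof.
move=> le_tu /eqP H; apply/eqP.
by rewrite -(subnK le_tu) iterD H iter_step_final.
Qed.

Lemma inWP e t k s : reflect (exists2 n, n < t & acc e k s n t) (inW e t k s).
Proof. exact: (sum_bool_gt0 t (fun n => acc e k s n t)). Qed.

Lemma inW_mono e t u k s : t <= u -> inW e t k s -> inW e u k s.
Proof.
move=> le_tu /inWP [n lt_nt Hn]; apply/inWP; exists n; first by lia.
exact: acc_mono Hn.
Qed.

Lemma okP e n k s : reflect
  (exists2 t, t < n & [&& k < t, s < t, good e t & inW e t k s]) (ok e n k s).
Proof. exact: (sum_bool_gt0 n (fun t => [&& k < t, s < t, good e t & inW e t k s])). Qed.

Lemma ok_mono e n m k s : n <= m -> ok e n k s -> ok e m k s.
Proof. by move=> le_nm /okP [t lt_tn H]; apply/okP; exists t => //; lia. Qed.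

Section Semimeasure.
Local Open Scope ring_scope.
Variable R : realType.
Implicit Types (x : R).

(** * Powers of one half and the mass of one program *)

Definition hpow k : R := 2 ^- k.

Lemma hpow_gt0 k : 0 < hpow k.
Proof. by rewrite invr_gt0 exprn_gt0. Qed.

Lemma hpowS k : hpow k.+1 = hpow k / 2.
Proof. by rewrite /hpow exprS invfM mulrC. Qed.

Lemma hpow0 : hpow 0 = 1.
Proof. by rewrite /hpow expr0 invr1. Qed.

Lemma hpowD j k : hpow (j + k) = hpow j * hpow k.
Proof. by rewrite /hpow exprD invfM. Qed.

Lemma hpow_mul2 k : hpow k * 2 ^+ k = 1.
Proof. by rewrite mulVf // expf_neq0 ?pnatr_eq0. Qed.

Lemma hpow_sub (j k : nat) : (k <= j)%N -> 2 ^+ (j - k) * hpow j = hpow k.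
Proof.
move=> le_kj; rewrite mulrC -[in hpow j](subnK le_kj) hpowD mulrAC.
by rewrite hpow_mul2 mul1r.
Qed.

Lemma hpow_small x : 0 < x -> exists k, hpow k < x.
Proof.
move=> x0; have := archi_boundP (ltW (etrans (invr_gt0 x) x0)).
set k := Num.bound _ => Hk; exists k.
rewrite /hpow invf_plt ?posrE ?exprn_gt0 //; apply: lt_trans Hk _.
by rewrite -natrX ltr_nat ltn_expl.
Qed.

Lemma sum_hpow n : \sum_(k < n) hpow k.+1 <= 1.
Proof.
suff -> : \sum_(k < n) hpow k.+1 = 1 - hpow n by have := hpow_gt0 n; lra.
elim: n => [|n IH]; first by rewrite big_ord0 hpow0 subrr.
by rewrite big_ord_recr /= IH hpowS; lra.
Qed.

(** The terms present start at the least k with 2^-k < x, and the whole tail from there sums to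
    2^-k. The induction carries the sharper bound x - 2^-n, which leaves room for the terms still to
    come. *)
Lemma sum_hpow_lt x n : 0 <= x -> \sum_(k < n) (hpow k < x)%R%:R * hpow k.+1 <= x.
Proof.
move=> x0; suff H : \sum_(k < n) (hpow k < x)%R%:R * hpow k.+1
    <= if hpow n < x then x - hpow n else 0.
  by apply: le_trans H _; have := hpow_gt0 n; case: ifP; lra.
elim: n => [|n IH].
  by rewrite big_ord0; case: ifP => //; lra.
rewrite big_ord_recr /= hpowS; have Hn := hpow_gt0 n.
by move: IH; case: (ltrP (hpow n) x); case: ifP; rewrite ?mul1r ?mul0r; lra.
Qed.

Lemma ler_sum_support n t (F : nat -> R) : (forall i, 0 <= F i) ->
  (forall i, (t <= i)%N -> F i = 0) -> \sum_(i < n) F i <= \sum_(i < t) F i.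
Proof.
move=> F0 Ft; rewrite -!(big_mkord xpredT); case: (leqP n t) => [le_nt|/ltnW le_tn].
  by rewrite (big_cat_nat _ le_nt) //= lerDl sumr_ge0.
rewrite (big_cat_nat _ le_tn) //= [X in _ + X]big_nat_cond [X in _ + X]big1 ?addr0 //.
by move=> i; rewrite andbT => /andP [/Ft].
Qed.

Lemma weightE e t : (weight e t)%:R * hpow t
  = \sum_(k < t) \sum_(s < t) (inW e t k s)%:R * hpow k.+1.
Proof.
rewrite natr_sum mulr_suml; apply: eq_bigr => k _.
rewrite natr_sum mulr_suml; apply: eq_bigr => s _.
by rewrite natrM natrX -mulrA hpow_sub.
Qed.

Lemma goodE e t : good e t =
  (\sum_(k < t) \sum_(s < t) (inW e t k s)%:R * hpow k.+1 <= 1).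
Proof. by rewrite -weightE ler_pdivrMr ?exprn_gt0 // mul1r -natrX ler_nat. Qed.

(* The sets [inW e t] increase with [t], so the last good [t < n] carries all of
   the mass granted before stage [n]. *)
Lemma sum_ok e n T :
  \sum_(s < T) \sum_(k < n) (ok e n k s)%:R * hpow k.+1 <= 1.
Proof.
case: (boolP [exists t : 'I_n, good e t]) => [/existsP [t0 good_t0]|no_good]; last first.
  rewrite big1 // => s _; rewrite big1 // => k _.
  case: okP => [[t lt_tn /and4P [_ _ good_t _]]|]; last by rewrite mul0r.
  by case/existsP: no_good; exists (Ordinal lt_tn).
have [t good_t t_max] := @arg_maxnP _ t0 (fun t : 'I_n => good e t) (@nat_of_ord n) good_t0.
move: good_t; rewrite goodE; apply: le_trans.
pose F s k := ((k < t)%N && ((s < t)%N && inW e t k s))%:R * hpow k.+1.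
have F0 s k : 0 <= F s k by rewrite mulr_ge0 // ltW // hpow_gt0.
apply: (@le_trans _ _ (\sum_(s < T) \sum_(k < n) F s k)).
  apply: ler_sum => s _; apply: ler_sum => k _.
  rewrite /F ler_wpM2r ?(ltW (hpow_gt0 _)) // ler_nat.
  case: okP => [[u lt_un /and4P [ku su good_u W]]|] //.
  have le_ut : (u <= t)%N by apply: (t_max (Ordinal lt_un)).
  by rewrite (leq_trans ku) // (leq_trans su) // (inW_mono le_ut W).
apply: (@le_trans _ _ (\sum_(s < t) \sum_(k < t) F s k)).
  apply: (@le_trans _ _ (\sum_(s < t) \sum_(k < n) F s k)).
    apply: (@ler_sum_support _ _ (fun s => \sum_(k < n) F s k)) => [s|s le_ts].
      by rewrite sumr_ge0.
    by rewrite big1 // => k _; rewrite /F [(s < t)%N]ltnNge le_ts andbF mul0r.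
  apply: ler_sum => s _; apply: ler_sum_support => // k le_tk.
  by rewrite /F ltnNge le_tk mul0r.
rewrite exchange_big /=; apply: ler_sum => k _; apply: ler_sum => s _.
by rewrite /F !ltn_ord.
Qed.

(** * The mixture, its limit and its universality *)

Definition approx n s : R :=
  \sum_(e < n) hpow e.+1 * \sum_(k < n) (ok e n k s)%:R * hpow k.+1.

Lemma massE n s : (mass n s)%:R * hpow (2 * n) = approx n s.
Proof.
rewrite natr_sum mulr_suml; apply: eq_bigr => e _.
rewrite natr_sum mulr_suml mulr_sumr; apply: eq_bigr => k _.
rewrite natrM natrX exprD mul2n -addnn hpowD -!(hpow_sub (ltn_ord _)); ring.
Qed.

Lemma approx_ge0 n s : 0 <= approx n s.
Proof.
apply: sumr_ge0 => e _; rewrite mulr_ge0 ?(ltW (hpow_gt0 _)) //.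
by apply: sumr_ge0 => k _; rewrite mulr_ge0 // ltW ?hpow_gt0.
Qed.

Lemma ler_sum_widen n m (F H : nat -> R) : (n <= m)%N -> (forall i, 0 <= H i) ->
  (forall i, F i <= H i) -> \sum_(i < n) F i <= \sum_(i < m) H i.
Proof.
move=> le_nm H0 FH; rewrite -!(big_mkord xpredT) (big_cat_nat _ le_nm) //=.
by apply: ler_wpDr; [rewrite sumr_ge0 | apply: ler_sum].
Qed.

Lemma approx_mono s : {homo (approx^~ s) : n m / (n <= m)%N >-> n <= m}.
Proof.
move=> n m le_nm.
pose F n e := hpow e.+1 * \sum_(k < n) (ok e n k s)%:R * hpow k.+1.
apply: (@ler_sum_widen _ _ (F n) (F m)) => // e.
  rewrite mulr_ge0 ?(ltW (hpow_gt0 _)) //.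
  by apply: sumr_ge0 => k _; rewrite mulr_ge0 // ltW ?hpow_gt0.
rewrite ler_wpM2l ?(ltW (hpow_gt0 _)) //.
apply: (@ler_sum_widen _ _ (fun k => (ok e n k s)%:R * hpow k.+1)
  (fun k => (ok e m k s)%:R * hpow k.+1)) => // k.
  by rewrite mulr_ge0 // ltW ?hpow_gt0.
rewrite ler_wpM2r ?(ltW (hpow_gt0 _)) // ler_nat.
by case: (boolP (ok e n k s)) => // /(ok_mono le_nm) ->.
Qed.

Lemma sum_approx n T : \sum_(s < T) approx n s <= 1.
Proof.
rewrite exchange_big /=; apply: le_trans (sum_hpow n); apply: ler_sum => e _.
by rewrite -mulr_sumr ler_piMr ?sum_ok // ltW ?hpow_gt0.
Qed.

Lemma approx_le1 n s : approx n s <= 1.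
Proof.
apply: le_trans (sum_approx n s.+1).
by rewrite big_ord_recr /= ler_wpDl // sumr_ge0 // => i _; apply: approx_ge0.
Qed.

Definition usm s : R := limn (approx^~ s).

Lemma approx_cvg s : (approx^~ s @ \oo --> usm s)%classic.
Proof.
apply: nondecreasing_is_cvgn; first exact: approx_mono.
by exists 1 => _ [n _ <-]; apply: approx_le1.
Qed.

Lemma approx_le n s : approx n s <= usm s.
Proof.
apply: nondecreasing_cvgn_le n; first exact: approx_mono.
by apply/cvg_ex; exists (usm s); apply: approx_cvg.
Qed.

Lemma sum_usm T : \sum_(s < T) usm s <= 1.
Proof.
have H : ((fun n => \sum_(s < T) approx n s) @ \oo --> \sum_(s < T) usm s)%classic.
  elim: T => [|T IH]; last first.
    under eq_fun do rewrite big_ord_recr /=.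
    by rewrite big_ord_recr /=; have := cvgD IH (@approx_cvg T); apply.
  by under eq_fun do rewrite big_ord0; rewrite big_ord0; apply: cvg_cst.
rewrite -(cvg_lim _ H) //; apply: limr_le; first by apply/cvg_ex; eexists; exact: H.
by apply: nearW => n; apply: sum_approx.
Qed.

(** The relation [h] presents the condition 2^-k < p(s) as recursively enumerable, and its quoted
    code is the program [e] whose share of the mixture dominates [p]. *)
Lemma usm_universal (h : nat -> nat -> nat -> bool) (p : nat -> R) :
  rec3 (fun k s n => h k s n : nat) ->
  (forall s, 0 <= p s) -> (forall T, \sum_(s < T) p s <= 1) ->
  (forall k s, (exists n, h k s n) <-> hpow k < p s) ->
  exists2 c, 0 < c & forall s, c * p s <= usm s.
Proof.
move=> [code_h Hh] p0 p1 hP; pose e := quote code_h.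
have run k s n : exists t, iter t step (st_eval e (CodeSeq.code [:: k; s; n]) 0)
    = st_ret (h k s n) 0.
  exact: (reval_computes (Hh [:: k; s; n] erefl)).
(* Both runs have halted by the common time t + u, so determinism forces their values to agree. *)
have acc_h k s n t : acc e k s n t -> h k s n.
  move=> /eqP Ht; have [u Hu] := run k s n.
  have: iter (t + u) step (st_eval e (CodeSeq.code [:: k; s; n]) 0) = st_ret 1 0.
    by rewrite addnC iterD Ht iter_step_final.
  rewrite iterD Hu iter_step_final => /(congr1 (fun z => hd (tl z))).
  by rewrite /st_ret !tl_cns !hd_cns; case: (h k s n).
have W_p t k s : inW e t k s -> hpow k < p s.
  by move=> /inWP [n _ /acc_h Hn]; apply/hP; exists n.
have good_e t : good e t.
  rewrite goodE exchange_big /=; apply: le_trans (p1 t); apply: ler_sum => s _.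
  apply: le_trans (sum_hpow_lt t (p0 s)); apply: ler_sum => k _.
  rewrite ler_wpM2r ?(ltW (hpow_gt0 _)) // ler_nat.
  by case: (boolP (inW _ _ _ _)) => // /W_p ->.
have p_le1 s : p s <= 1.
  apply: le_trans (p1 s.+1).
  by rewrite big_ord_recr /= ler_wpDl // sumr_ge0.
(* [hpow e.+1] is the weight of [e] in the mixture. If j is least with 2^-j < p(s), then p(s) <=
   2^-(j-1), which is 4 times the mass 2^-(j+1) granted at j. *)
exists (hpow e.+1 / 4) => [|s]; first by rewrite divr_gt0 ?hpow_gt0.
have := p0 s; rewrite le_eqVlt => /predU1P [<-|ps0].
  by rewrite mulr0; apply: le_trans (approx_le 0 s); apply: approx_ge0.
(* The least index is not 0, since p(s) <= 1 = 2^-0. *)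
have [[|k] Hk k_min] := ex_minnP (hpow_small ps0).
  by have := p_le1 s; rewrite leNgt -hpow0 Hk.
have {k_min} ps_le : p s <= hpow k by rewrite leNgt; apply/negP => /k_min; rewrite ltnn.
have [n hn] := (hP k.+1 s).2 Hk.
have [t Ht] := run k.+1 s n; rewrite hn in Ht.
(* A stage beyond k + 1, s, the witness n and the halting time t. *)
pose u := (k + s + n + t).+2.
have W : inW e u k.+1 s.
  apply/inWP; exists n; first by lia.
  by apply: (@acc_mono _ _ _ _ t); [lia | apply/eqP].
pose m := (u + e).+1.
have okm : ok e m k.+1 s.
  by apply/okP; exists u; [rewrite /m; lia | rewrite good_e W !andbT /u; lia].
apply: le_trans (approx_le m s).
have lt_em : (e < m)%N by lia.
have lt_km : (k.+1 < m)%N by lia.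
rewrite /approx (bigD1 (Ordinal lt_em)) //=; apply: ler_wpDr.
  apply: sumr_ge0 => i _; rewrite mulr_ge0 ?(ltW (hpow_gt0 _)) //.
  by apply: sumr_ge0 => j _; rewrite mulr_ge0 // ltW ?hpow_gt0.
rewrite -mulrA ler_wpM2l ?(ltW (hpow_gt0 _)) //.
rewrite (bigD1 (Ordinal lt_km)) //=; apply: ler_wpDr.
  by apply: sumr_ge0 => j _; rewrite mulr_ge0 // ltW ?hpow_gt0.
by rewrite okm mul1r !hpowS; lra.
Qed.

End Semimeasure.

(** * Encodings of rational matrices *)

Lemma pickle_pair (T U : countType) (x : T) (y : U) :
  pickle (x, y) = cns (pickle x) (cns (pickle y) 0).
Proof. by []. Qed.

Lemma pickle_rat (q : rat) : pickle q = pickle (valq q).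
Proof. by []. Qed.

Definition pickle_posz p := cns (cns p 0) (cns 0 0).

Lemma pickle_Posz p : pickle (Posz p) = pickle_posz p.
Proof. by []. Qed.

Lemma hd_hd_pickle_int (z : int) : hd (hd (pickle z)) = if z is Posz p then p else 0.
Proof.
case: z => p; first by rewrite pickle_Posz /pickle_posz !hd_cns.
by rewrite -[pickle _]/(cns 0 (cns (cns p 0) 0)) hd_cns.
Qed.

(** A matrix is a finite function, encoded as its graph in the order of [enum]: each item holds the
    index pair and then the value. *)
Lemma pickle_mx N (A : 'M[rat]_N) : pickle A =
  CodeSeq.code [seq cns (pickle ij) (cns (pickle (A ij.1 ij.2)) 0)
               | ij <- enum {: 'I_N * 'I_N}].
Proof.
transitivity (pickle (map (total_fun (mx_val A)) (enum {: 'I_N * 'I_N}))); first by [].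
rewrite -[LHS]/(CodeSeq.code (map pickle _)) -map_comp.
congr CodeSeq.code; apply: eq_map => -[i j] /=.
by [].
Qed.

Lemma rec_code (T : Type) (F : T -> seq nat -> nat) n l :
  (forall i, rec n (F i)) -> rec n (fun xs => CodeSeq.code [seq F i xs | i <- l]).
Proof.
by move=> HF; elim: l => [|i l IH]; [apply: rec_const | apply: reccns].
Qed.

Lemma hd_iter_tl_code i l : hd (iter i tl (CodeSeq.code l)) = nth 0 l i.
Proof.
elim: i l => [|i IH] l.
  by case: l => [|x l] //; rewrite code_cons hd_cns.
by rewrite iterSr; case: l => [|x l]; rewrite ?nth_nil ?(IH [::]) ?code_cons ?tl_cns ?IH ?nth_nil.
Qed.

(** Every number codes a list of naturals; it codes a string when no entry exceeds 1. A list is no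
    longer than its code, so the positions below [s] suffice. *)
Definition is_bstring s := \sum_(i < s) (1 < hd (iter i tl s)) == 0.

Lemma pickle_bstring (w : bstring) : pickle w = CodeSeq.code (map nat_of_bool w).
Proof. by []. Qed.

Lemma is_bstringP s : reflect (exists w : bstring, s = pickle w) (is_bstring s).
Proof.
rewrite /is_bstring sum_nat_eq0; apply: (iffP forallP) => [H|[w ->] i]; last first.
  rewrite /= eqb0 -leqNgt; move: {i}(nat_of_ord i) => i.
  rewrite pickle_bstring hd_iter_tl_code.
  case: (ltnP i (size w)) => Hi; first by rewrite (nth_map false) // leq_b1.
  by rewrite nth_default // size_map.
have {H} H i : nth 0 (CodeSeq.decode s) i <= 1.
  case: (ltnP i s) => Hi.
    have := H (Ordinal Hi); rewrite /= eqb0 -leqNgt.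
    by rewrite -hd_iter_tl_code CodeSeq.decodeK.
  rewrite nth_default // (leq_trans _ Hi) //.
  rewrite -[leqRHS]CodeSeq.decodeK; elim: (CodeSeq.decode s) => //= x l IH.
  have := expn_gt0 2 x; nia.
exists [seq x == 1 | x <- CodeSeq.decode s].
rewrite pickle_bstring -[LHS]CodeSeq.decodeK -map_comp; congr CodeSeq.code.
apply: (@eq_from_nth _ 0) => [|i Hi]; first by rewrite size_map.
by rewrite (nth_map 0) //=; have := H i; case: (nth 0 _ i) => [|[|]].
Qed.

Lemma rec_is_bstring : rec1 (fun s => is_bstring s : nat).
Proof.
apply: receq; last exact: rec_const.
apply: (@recsum 1 _ (fun i xs => 1 < hd (iter i tl (nth 0 xs 0)))); first by rec_auto.
apply: recleq; first exact: rec_const.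
apply: rechd; apply: reciter; [apply: rectl | |]; rec_auto.
Qed.

(** For [y] the code of a pair of matrices, this is the code of the [j]-th entry of the first; [tl]
    skips the index stored with the value. *)
Definition entry_code j y := hd (tl (hd (iter j tl (hd y)))).

(* A negative numerator is decoded as 0, which makes the test fail as it should. *)
Definition entry_gt j k y :=
  hd (hd (hd (tl (entry_code j y)))) < hd (hd (hd (entry_code j y))) * 2 ^ k.

Lemma rec_entry_gt j : rec2 (fun k y => entry_gt j k y : nat).
Proof.
have H : rec1 (entry_code j).
  by rewrite /rec1 /entry_code; rec_auto; apply: reciter; [apply: rectl | |]; rec_auto.
have Hy : rec 2 (fun xs => entry_code j (nth 0 xs 1)) by apply: rec_comp1 => //; rec_auto.
by apply: recleq; [apply: recS | apply: recM]; rec_auto; exact: Hy.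
Qed.

Lemma entry_codeE N (A B : 'M[rat]_N) i j :
  entry_code (index (i, j) (enum {: 'I_N * 'I_N})) (pickle (A, B)) = pickle (A i j).
Proof.
rewrite /entry_code pickle_pair hd_cns pickle_mx hd_iter_tl_code.
rewrite (nth_map (i, j)) ?index_mem ?mem_enum // nth_index ?mem_enum //.
by rewrite tl_cns hd_cns.
Qed.

Section RationalEntries.
Local Open Scope ring_scope.

Lemma entry_gtE N (A B : 'M[rat]_N) i j k :
  entry_gt (index (i, j) (enum {: 'I_N * 'I_N})) k (pickle (A, B)) = (2 ^- k < A i j).
Proof.
rewrite /entry_gt entry_codeE pickle_rat; set q := A i j.
rewrite [valq q]surjective_pairing pickle_pair -/(numq q) -/(denq q).
rewrite tl_cns (hd_cns (pickle (denq q))) (hd_cns (pickle (numq q))).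
rewrite !hd_hd_pickle_int -[in RHS](divq_num_den q).
rewrite ltr_pdivlMr ?ltr0z ?denq_gt0 // mulrC ltr_pdivrMr ?exprn_gt0 //.
case: (denqP q) => d ->; case: (numq q) => p.
  by rewrite -!pmulrn -natrX -natrM ltr_nat.
rewrite mul0n ltn0; symmetry; apply/negbTE; rewrite -leNgt.
apply: (@le_trans _ _ 0) => //.
by rewrite mulr_le0_ge0 ?exprn_ge0 // lerz0.
Qed.

Definition dyadic (m L : nat) : rat := m%:R / 2 ^+ L.

Lemma pickle_dyadic m L : odd m ->
  pickle (dyadic m L) = cns (pickle_posz m) (cns (pickle_posz (2 ^ L)) 0).
Proof.
move=> odd_m; rewrite pickle_rat [valq _]surjective_pairing -/(numq _) -/(denq _).
have cop : coprime `|m%:Z| `|(2 ^ L)%:Z| by rewrite /= coprimeXr // coprimen2.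
have -> : dyadic m L = m%:Z%:Q / (2 ^ L)%N%:Z%:Q by rewrite /dyadic -natrX.
rewrite coprimeq_num // coprimeq_den //.
have -> : Num.sg (2 ^ L)%N%:Z = 1 by rewrite gtr0_sg // ltz_nat expn_gt0.
by rewrite mul1r eqz_nat expn_eq0 /= pickle_pair !pickle_Posz.
Qed.

End RationalEntries.

Local Open Scope ring_scope.

(** * Positive semi-definite matrices *)

Section Psd.
Variables (R : realType) (N : nat).
Local Notation C := R[i].
Implicit Types (A B : 'M[C]_N) (v : 'rV[C]_N).

Lemma conjC_real (x : R) : (x%:C%C)^* = x%:C%C :> C.
Proof. exact: conjc_real. Qed.

Lemma hermitianP A : Defs.hermitian A <-> forall i j, A i j = (A j i)^*.
Proof.
rewrite /Defs.hermitian; split=> [/is_hermitianmxP|] H.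
  by move=> i j; rewrite {1}H expr0 scale1r !mxE.
by apply/is_hermitianmxP; rewrite expr0 scale1r; apply/matrixP => i j; rewrite !mxE.
Qed.

Definition qform A v := \sum_i \sum_j v 0 i * A i j * (v 0 j)^*.

Lemma qformE A v : qform A v = \sum_i \sum_j v 0 i * A i j * (v 0 j)^*.
Proof. by []. Qed.

Lemma psdP A : psd A <-> Defs.hermitian A /\ forall v, 0 <= qform A v.
Proof.
have E v : (v *m A *m (map_mx Num.conj v)^T) 0 0 = qform A v.
  rewrite mxE /qform exchange_big /=; apply: eq_bigr => j _.
  by rewrite !mxE mulr_suml; apply: eq_bigr => i _.
by split=> -[H Q]; split=> // v; have := Q v; rewrite E.
Qed.

Lemma hermitianD A B : Defs.hermitian A -> Defs.hermitian B -> Defs.hermitian (A + B).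
Proof.
move=> /hermitianP HA /hermitianP HB; apply/hermitianP => i j.
by rewrite !mxE HA HB rmorphD.
Qed.

Lemma psdD A B : psd A -> psd B -> psd (A + B).
Proof.
move=> /psdP [hA qA] /psdP [hB qB]; apply/psdP; split=> [|v]; first exact: hermitianD.
have -> : qform (A + B) v = qform A v + qform B v; last exact: addr_ge0.
rewrite /qform -big_split; apply: eq_bigr => i _ /=; rewrite -big_split.
by apply: eq_bigr => j _ /=; rewrite mxE; ring.
Qed.

Lemma psdZ (c : R) A : 0 <= c -> psd A -> psd (c%:C%C *: A).
Proof.
move=> c0 /psdP [/hermitianP hA qA]; apply/psdP; split=> [|v].
  by apply/hermitianP => i j; rewrite !mxE hA rmorphM /= conjC_real.
have -> : qform (c%:C%C *: A) v = c%:C%C * qform A v.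
  rewrite /qform mulr_sumr; apply: eq_bigr => i _ /=; rewrite mulr_sumr.
  by apply: eq_bigr => j _ /=; rewrite mxE; ring.
by rewrite mulr_ge0 // ler0c.
Qed.

Lemma sum_delta (F : 'I_N -> C) j : \sum_i (i == j)%:R * F i = F j.
Proof.
rewrite (bigD1 j) //= eqxx mul1r big1 ?addr0 // => i /negbTE ->.
by rewrite mul0r.
Qed.

Lemma qform_delta2 A i j (x y : C) :
  qform A (x *: delta_mx 0 i + y *: delta_mx 0 j) =
  x * A i i * x^* + x * A i j * y^* + y * A j i * x^* + y * A j j * y^*.
Proof.
transitivity (\sum_k \sum_l ((k == i)%:R * ((l == i)%:R * (x * A k l * x^*))
  + (k == i)%:R * ((l == j)%:R * (x * A k l * y^*))
  + (k == j)%:R * ((l == i)%:R * (y * A k l * x^*))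
  + (k == j)%:R * ((l == j)%:R * (y * A k l * y^*)))).
  apply: eq_bigr => k _; apply: eq_bigr => l _; rewrite !mxE /=.
  by rewrite rmorphD !rmorphM /= !conjC_nat; ring.
under eq_bigr do rewrite !big_split /= -!mulr_sumr !sum_delta.
by rewrite !big_split /= !sum_delta.
Qed.

Lemma psd_diag_ge0 A i : psd A -> 0 <= A i i.
Proof.
move=> /psdP [_ /(_ (1 *: delta_mx 0 i + 0 *: delta_mx 0 i))]; rewrite qform_delta2.
by rewrite conjC0 conjC1 !(mul0r, mulr0, addr0, mul1r, mulr1).
Qed.

(* With x_i := v_i e_i, positivity of the form at every x_i - x_j gives
   q(x_1 + ... + x_N) <= N (q(x_1) + ... + q(x_N)). *)
Lemma psd_le_scalar A (x : R) : psd A -> (forall i, N%:R * A i i <= x%:C%C) ->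
  psd ((x%:C%C)%:M - A).
Proof.
move=> /psdP [/hermitianP hA qA] Ax; apply/psdP; split=> [|v].
  apply/hermitianP => i j; rewrite !mxE rmorphB /= -hA eq_sym.
  by case: (j == i); rewrite ?mulr1n ?mulr0n ?conjC0 ?conjC_real.
have pair_ge0 i j : 0 <= v 0 i * A i i * (v 0 i)^* + v 0 j * A j j * (v 0 j)^*
    - v 0 i * A i j * (v 0 j)^* - v 0 j * A j i * (v 0 i)^*.
  have := qA (v 0 i *: delta_mx 0 i + (- v 0 j) *: delta_mx 0 j).
  by rewrite qform_delta2 rmorphN /=; congr (0 <= _); ring.
have sum_ge0 : 0 <= \sum_i \sum_j (v 0 i * A i i * (v 0 i)^* + v 0 j * A j j * (v 0 j)^*
    - v 0 i * A i j * (v 0 j)^* - v 0 j * A j i * (v 0 i)^*).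
  by apply: sumr_ge0 => i _; apply: sumr_ge0.
have sumE : \sum_i \sum_j (v 0 i * A i i * (v 0 i)^* + v 0 j * A j j * (v 0 j)^*
    - v 0 i * A i j * (v 0 j)^* - v 0 j * A j i * (v 0 i)^*)
    = 2 * (N%:R * (\sum_i v 0 i * A i i * (v 0 i)^*) - qform A v).
  under eq_bigr do rewrite !sumrB big_split /= sumr_const card_ord.
  rewrite !sumrB big_split /= sumr_const card_ord sumrMnl.
  have -> : \sum_i \sum_j v 0 j * A j i * (v 0 i)^* = qform A v.
    by rewrite exchange_big.
  rewrite -qformE.
  move: (\sum_i _) (qform A v) => D q.
  by rewrite -[D *+ N]mulr_natl; ring.
have {sum_ge0} diag_ge : 0 <= N%:R * (\sum_i v 0 i * A i i * (v 0 i)^*) - qform A v.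
  by move: sum_ge0; rewrite sumE pmulr_rge0.
have -> : qform ((x%:C%C)%:M - A) v = x%:C%C * (\sum_i v 0 i * (v 0 i)^*) - qform A v.
  rewrite /qform mulr_sumr -sumrB; apply: eq_bigr => i _.
  under eq_bigr do rewrite !mxE mulrBr mulrBl.
  rewrite sumrB; congr (_ - _); rewrite (bigD1 i) //= eqxx mulr1n big1 ?addr0 => [|j].
    by ring.
  by rewrite eq_sym => /negbTE ->; rewrite mulr0n mulr0 mul0r.
apply: le_trans diag_ge _; rewrite lerD2r !mulr_sumr; apply: ler_sum => i _.
rewrite [X in X <= _](_ : _ = N%:R * A i i * (v 0 i * (v 0 i)^*)); last by ring.
by rewrite ler_wpM2r ?Ax // mul_conjC_ge0.
Qed.

(** * Scalar matrices perturbed in a two-dimensional block *)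

Variables (i0 i1 : 'I_N).
Hypothesis neq01 : i0 != i1.

(** The matrix p I + a E00 + b (E01 + E10), with 0 and 1 standing for [i0] and [i1]. *)
Definition kmx (p a b : R) : 'M[C]_N :=
  \matrix_(i, j) (if i == j then (if i == i0 then p + a else p)
    else if (i == i0) && (j == i1) || (i == i1) && (j == i0) then b else 0)%:C%C.

Lemma kmx_sym p a b i j : kmx p a b i j = kmx p a b j i.
Proof.
rewrite !mxE [j == i]eq_sym; case: eqVneq => [->|_] //.
by rewrite orbC [(i == i0) && _]andbC [(i == i1) && _]andbC.
Qed.

Lemma kmxD p a b p' a' b' : kmx p a b + kmx p' a' b' = kmx (p + p') (a + a') (b + b').
Proof.
apply/matrixP => i j; rewrite !mxE -rmorphD /=; congr (_%:C%C).
by do ![case: ifP => _]; ring.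
Qed.

Lemma kmxB p a b p' a' b' : kmx p a b - kmx p' a' b' = kmx (p - p') (a - a') (b - b').
Proof.
apply/matrixP => i j; rewrite !mxE -rmorphB /=; congr (_%:C%C).
by do ![case: ifP => _]; ring.
Qed.

Lemma kmx_scalar p : kmx p 0 0 = (p%:C%C)%:M.
Proof.
apply/matrixP => i j; rewrite !mxE addr0 !if_same.
by case: eqP; rewrite ?mulr1n ?mulr0n.
Qed.

Lemma kmx_sum (T : Type) (l : seq T) (p a b : T -> R) :
  \sum_(s <- l) kmx (p s) (a s) (b s)
  = kmx (\sum_(s <- l) p s) (\sum_(s <- l) a s) (\sum_(s <- l) b s).
Proof.
elim: l => [|s l IH]; last by rewrite !big_cons IH kmxD.
by rewrite !big_nil kmx_scalar raddf0.
Qed.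

Lemma kmx_herm p a b : Defs.hermitian (kmx p a b).
Proof.
apply/hermitianP => i j; by rewrite kmx_sym mxE conjC_real.
Qed.

Lemma qform_kmx p a b v : qform (kmx p a b) v = p%:C%C * (\sum_i v 0 i * (v 0 i)^*)
  + a%:C%C * (v 0 i0 * (v 0 i0)^*)
  + b%:C%C * (v 0 i0 * (v 0 i1)^* + v 0 i1 * (v 0 i0)^*).
Proof.
pose d (i j : 'I_N) : C := (i == j)%:R.
transitivity (\sum_i \sum_j (d j i * (p%:C%C * v 0 i * (v 0 j)^*)
   + d i i0 * (d j i0 * (a%:C%C * v 0 i * (v 0 j)^*))
   + d i i0 * (d j i1 * (b%:C%C * v 0 i * (v 0 j)^*))
   + d i i1 * (d j i0 * (b%:C%C * v 0 i * (v 0 j)^*)))).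
  apply: eq_bigr => i _; apply: eq_bigr => j _; rewrite mxE /d [j == i]eq_sym.
  have [<-|neq_ij] := eqVneq i j.
    have [->|ni0] := eqVneq i i0; first by rewrite (negbTE neq01) rmorphD /=; ring.
    by case: (i == i1) => /=; ring.
  have [ei|ni0] := eqVneq i i0.
    rewrite ei in neq_ij *; rewrite [j == i0]eq_sym (negbTE neq_ij) (negbTE neq01).
    by case: (j == i1); rewrite /= ?rmorph0; ring.
  by case: (i == i1); case: (j == i0); case: (j == i1); rewrite /= ?rmorph0; ring.
under eq_bigr do rewrite !big_split /= sum_delta -!mulr_sumr !sum_delta.
rewrite !big_split /= !sum_delta mulr_sumr mulrDr addrA.
by congr (_ + _ + _ + _); first apply: eq_bigr => i _; ring.
Qed.

(** Diagonal dominance: the cross term is absorbed into |b| |x + y|^2 or |b| |x - y|^2 according to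
    the sign of b, and the remaining squares have nonnegative coefficients. *)
Lemma kmx_psd p a b : `|b| <= p -> `|b| <= p + a -> psd (kmx p a b).
Proof.
move=> bp bpa; apply/psdP; split=> [|v]; first exact: kmx_herm.
rewrite qform_kmx (bigD1 i0) //= (bigD1 i1) 1?eq_sym //=.
set S := \sum_(i | _) _.
have S0 : 0 <= S by apply: sumr_ge0 => i _; apply: mul_conjC_ge0.
have p0 : 0 <= p by apply: le_trans bp.
set x := v 0 i0; set y := v 0 i1.
have sq z : 0 <= z * z^* :> C by apply: mul_conjC_ge0.
case: (lerP 0 b) => b0.
  have -> : p%:C%C * (x * x^* + (y * y^* + S)) + a%:C%C * (x * x^*)
      + b%:C%C * (x * y^* + y * x^*)
    = (p + a - b)%:C%C * (x * x^*) + (p - b)%:C%C * (y * y^*) + p%:C%C * S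
      + b%:C%C * ((x + y) * (x + y)^*).
    by rewrite !rmorphB !rmorphD /=; ring.
  rewrite ger0_norm // in bp bpa.
  by rewrite !addr_ge0 // mulr_ge0 // ler0c //; lra.
have -> : p%:C%C * (x * x^* + (y * y^* + S)) + a%:C%C * (x * x^*)
    + b%:C%C * (x * y^* + y * x^*)
  = (p + a + b)%:C%C * (x * x^*) + (p + b)%:C%C * (y * y^*) + p%:C%C * S
    + (- b)%:C%C * ((x - y) * (x - y)^*).
  by rewrite !rmorphN !rmorphB !rmorphD /=; ring.
rewrite ltr0_norm // in bp bpa.
by rewrite !addr_ge0 // mulr_ge0 // ler0c //; lra.
Qed.

Lemma kmx_mul01 p a b p' a' b' :
  (kmx p a b *m kmx p' a' b') i0 i1 = ((p + a) * b' + b * p')%:C%C.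
Proof.
have neq10 : (i1 == i0) = false by rewrite eq_sym (negbTE neq01).
rewrite mxE (bigD1 i0) //= (bigD1 i1) 1?eq_sym //= big1 => [|k /andP [k0 k1]]; last first.
  by rewrite !mxE [i0 == k]eq_sym (negbTE k0) (negbTE k1) !andbF mul0r.
by rewrite !mxE !eqxx (negbTE neq01) neq10 /= addr0 -!rmorphM -rmorphD.
Qed.

(** The scalar parts cancel, and the ([i0], [i1]) entry of the commutator is a b' - a' b. *)
Lemma kmx_noncomm p a b p' a' b' : a * b' != a' * b ->
  kmx p a b *m kmx p' a' b' - kmx p' a' b' *m kmx p a b != 0.
Proof.
apply: contraNneq => /matrixP /(_ i0 i1); rewrite mxE [X in _ + X]mxE !kmx_mul01 mxE.
rewrite -rmorphB /= => -[] H; apply/eqP; lra.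
Qed.

End Psd.

(** * Domination of lower-computable semi-POVMs *)

(** The explicit test makes decoding followed by encoding recursive: it is the identity on codes of
    strings and 0 elsewhere. *)
Definition unpickle_bstring (s : nat) : bstring :=
  if is_bstring s then odflt [::] (unpickle s) else [::].

Lemma pickle_unpickle_bstring s :
  pickle (unpickle_bstring s) = if is_bstring s then s else 0%N.
Proof.
rewrite /unpickle_bstring; case: ifP => // /is_bstringP [w ->].
by rewrite pickleK.
Qed.

Lemma is_bstring_pickle (w : bstring) : is_bstring (pickle w).
Proof. by apply/is_bstringP; exists w. Qed.

Lemma unpickle_bstringK (w : bstring) : unpickle_bstring (pickle w) = w.
Proof. by apply: (pcan_inj pickleK); rewrite pickle_unpickle_bstring is_bstring_pickle. Qed.

Lemma rec_total_recursive (T U : countType) (f : T -> U) n (F : seq nat -> T) :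
  total_recursive f -> rec n (fun xs => pickle (F xs)) -> rec n (fun xs => pickle (f (F xs))).
Proof.
move=> [c Hc] [d Hd]; exists (RComp c [:: d]) => xs sz.
apply: (@reval_comp _ _ _ [:: pickle (F xs)]); last exact: Hc.
by do ?constructor; apply: Hd.
Qed.

(** As [pickle] is injective, a sum over distinct strings is part of a sum over an initial segment
    of the numbers. *)
Lemma sum_pickle_le1 (R : realType) (F : nat -> R) (l : seq bstring) :
  (forall s, 0 <= F s) -> (forall T, \sum_(s < T) F s <= 1) -> uniq l ->
  \sum_(w <- l) F (pickle w) <= 1.
Proof.
move=> F0 F1 Ul; pose l' := [seq pickle w | w <- l].
have Ul' : uniq l' by rewrite map_inj_uniq //; apply: pcan_inj pickleK.
pose T := (\max_(s <- l') s).+1.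
have pe : perm_eq l' [seq i <- index_iota 0 T | i \in l'].
  apply: uniq_perm => [//||s]; first by rewrite filter_uniq ?iota_uniq.
  rewrite mem_filter mem_index_iota /=; case: (boolP (s \in l')) => //= sl.
  by rewrite ltnS leq_bigmax_seq.
rewrite -(big_map pickle xpredT F) -/l' (perm_big _ pe) big_filter.
apply: le_trans (F1 T); rewrite -(big_mkord xpredT) [leRHS](bigID (mem l')) /=.
by rewrite lerDl sumr_ge0.
Qed.

Section Domination.
Variables (R : realType) (N : nat).
Local Notation C := R[i].
Variables (P : bstring -> 'M[C]_N) (f : nat * bstring -> 'M[rat]_N * 'M[rat]_N).
Hypothesis P_povm : semiPOVM P.
Hypothesis f_rec : total_recursive f.
Hypothesis f_cvg : forall s, mx_cvg (fun n => herQ_val R (f (n, s))) (P s).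
Hypothesis f_le : forall n s, loewner_le (herQ_val R (f (n, s))) (P s).

Lemma povm_psd w : psd (P w).
Proof. by case: P_povm => /(_ w) + _; rewrite /loewner_le subr0. Qed.

Lemma povm_diag w i : P w i i = (complex.Re (P w i i))%:C%C.
Proof. by rewrite RRe_real // ger0_real // psd_diag_ge0 //; apply: povm_psd. Qed.

Lemma povm_diag_ge0 w i : 0 <= complex.Re (P w i i).
Proof. by rewrite -ler0c -povm_diag psd_diag_ge0 //; apply: povm_psd. Qed.

Definition povm_entry i s : R :=
  if is_bstring s then complex.Re (P (unpickle_bstring s) i i) else 0.

(** Subtracting from I the sum of [P] over the strings with code below [T] leaves a matrix whose (i,
    i) entry is nonnegative. *)
Lemma sum_povm_entry i T : \sum_(s < T) povm_entry i s <= 1.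
Proof.
pose l := [seq unpickle_bstring s | s <- index_iota 0 T & is_bstring s].
have Ul : uniq l.
  rewrite map_inj_in_uniq ?filter_uniq ?iota_uniq // => s t.
  rewrite !mem_filter => /andP [bs _] /andP [bt _] /(congr1 pickle).
  by rewrite !pickle_unpickle_bstring bs bt.
have -> : \sum_(s < T) povm_entry i s = \sum_(w <- l) complex.Re (P w i i).
  rewrite big_map big_filter -(big_mkord xpredT (povm_entry i)) [RHS]big_mkcond.
  by apply: eq_bigr.
case: P_povm => _ /(_ l Ul) /(psd_diag_ge0 i).
rewrite !mxE eqxx mulr1n summxE (eq_bigr (fun w => (complex.Re (P w i i))%:C%C)).
  by rewrite -rmorph_sum /= -rmorphB ler0c subr_ge0.
by move=> w _; apply: povm_diag.
Qed.

Lemma ratr_hpow k (q : rat) : (2 ^- k < q) = (hpow R k < ratr q).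
Proof. by rewrite -(ltr_rat R) fmorphV rmorphXn /= ratr_nat. Qed.

(** The strict inequality is an open condition, so it passes from the limit to some approximation;
    conversely each approximation lies below [P], hence so does its diagonal. *)
Lemma exists_entry_gt i k w :
  (exists n, 2 ^- k < (f (n, w)).1 i i) <-> hpow R k < complex.Re (P w i i).
Proof.
split=> [[n]|lt_kP].
  rewrite ratr_hpow => /lt_le_trans; apply.
  have := psd_diag_ge0 i (f_le n w); rewrite !mxE povm_diag.
  by rewrite lecE /= subr_ge0 => /andP [].
have [+ _] := f_cvg w i i; move=> /cvgr_gt /(_ _ lt_kP) /filter_ex [n].
by rewrite mxE /= -ratr_hpow; exists n.
Qed.

Lemma usm_dominates_entry i :
  exists2 c : R, 0 < c & forall w, c * complex.Re (P w i i) <= usm R (pickle w).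
Proof.
pose j := index (i, i) (enum {: 'I_N * 'I_N}).
pose h k s n := is_bstring s && entry_gt j k (pickle (f (n, unpickle_bstring s))).
have [||T|k s|c c0 Hc] := @usm_universal R h (povm_entry i).
- apply: recand; first by apply: (rec_comp1 rec_is_bstring); rec_auto.
  apply: (rec_comp2 (rec_entry_gt j)); first by rec_auto.
  apply: (rec_total_recursive (F := fun xs =>
    (nth 0%N xs 2, unpickle_bstring (nth 0%N xs 1)))) => //.
  apply: (rec_ext (f := fun xs => cns (nth 0%N xs 2)
    (cns (if is_bstring (nth 0%N xs 1) then nth 0%N xs 1 else 0%N) 0))).
    by rec_auto; apply: (rec_comp1 rec_is_bstring); rec_auto.
  by move=> xs _; rewrite pickle_pair pickle_unpickle_bstring.
- by move=> s; rewrite /povm_entry; case: ifP => // _; apply: povm_diag_ge0.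
- exact: sum_povm_entry.
- rewrite /h /povm_entry; case: ifP => _ /=; last first.
    by split=> [[]//|]; rewrite ltNge ltW // hpow_gt0.
  rewrite -exists_entry_gt; split=> -[n Hn]; exists n; move: Hn;
    by rewrite [f _]surjective_pairing entry_gtE.
- exists c => // w; have := Hc (pickle w).
  by rewrite /povm_entry is_bstring_pickle unpickle_bstringK.
Qed.

Lemma usm_dominates :
  exists2 c : R, 0 < c & forall w, psd ((usm R (pickle w))%:C%C%:M - c%:C%C *: P w).
Proof.
have /choice [c cP] i : exists c : R,
    0 < c /\ forall w, c * complex.Re (P w i i) <= usm R (pickle w).
  by have [c c0 Hc] := usm_dominates_entry i; exists c.
pose m := \big[Num.min/1]_i c i.
have m0 : 0 < m by apply: lt_bigmin => [|i _]; [apply: ltr01 | have [] := cP i].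
(* [psd_le_scalar] costs a factor N, which the division by N + 1 absorbs without ever dividing by
   0. *)
exists (m / N.+1%:R) => [|w]; first by rewrite divr_gt0.
apply: psd_le_scalar => [|i].
  by apply: psdZ; [rewrite divr_ge0 // ltW | apply: povm_psd].
rewrite mxE povm_diag -rmorphM /=.
have -> : (N%:R : C) = (N%:R : R)%:C%C by rewrite rmorph_nat.
rewrite -rmorphM lecR; apply: le_trans ((cP i).2 w).
have le_mc : m <= c i by apply: bigmin_le.
have P0 := povm_diag_ge0 w i.
rewrite mulrA ler_wpM2r // (le_trans _ le_mc) // mulrCA ler_piMr ?ltW //.
by rewrite ltr_pdivrMr // mul1r ltr_nat.
Qed.

End Domination.

(** * The non-commuting universal semi-POVM *)

Section Universal.
Variables (R : realType) (N : nat) (i0 i1 : 'I_N).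
Hypothesis neq01 : i0 != i1.
Local Notation C := R[i].
Local Notation hpow := (hpow R).

Definition upovm (w : bstring) : 'M[C]_N :=
  let s := pickle w in
  kmx i0 i1 (usm R s / 4 + hpow (s + 3)) (hpow (2 * s + 3)) (hpow (s + 3)).

(** Exponent of a common denominator for the mixture over 4, 2^-(s+3) and 2^-(2s+3), large enough to
    make all three numerators even. *)
Definition expo n s := (2 * n + 2 * s + 6)%N.

(* Subtracting 2^-[expo n s] makes the numerator odd, so that the dyadic number is
   already in lowest terms and its encoding needs no gcd. *)
Definition numer n s := (mass n s * 2 ^ (2 * s + 4) + 2 ^ (2 * n + s + 3)).-1.

Definition numer0 n s := (numer n s + 2 ^ (2 * n + 3))%N.

Definition upovm_approx (x : nat * bstring) : 'M[rat]_N * 'M[rat]_N :=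
  let n := x.1 in let s := pickle x.2 in
  (\matrix_(i, j)
     (if i == j then dyadic (if i == i0 then numer0 n s else numer n s) (expo n s)
      else if (i == i0) && (j == i1) || (i == i1) && (j == i0) then dyadic 1 (s + 3)
      else 0), 0).

Lemma odd_numer n s : odd (numer n s).
Proof.
rewrite /numer; set x := (_ + _)%N.
have x0 : (0 < x)%N by rewrite addn_gt0 expn_gt0 orbT.
have : ~~ odd x by rewrite oddD oddM !oddX /= !addn_eq0 /= !andbF.
by move: x0; case: (x) => //= m _; rewrite negbK.
Qed.

Lemma odd_numer0 n s : odd (numer0 n s).
Proof. by rewrite oddD odd_numer oddX addn_eq0 /= andbF. Qed.

Lemma ratr_dyadic m L : ratr (dyadic m L) = m%:R * hpow L :> R.
Proof. by rewrite /dyadic fmorph_div rmorphXn /= !ratr_nat. Qed.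

Lemma numerE n s : (numer n s)%:R * hpow (expo n s)
  = approx R n s / 4 + hpow (s + 3) - hpow (expo n s).
Proof.
rewrite /numer -subn1 natrB ?addn_gt0 ?expn_gt0 ?orbT // natrD natrM !natrX.
have h4 : 2 ^+ (2 * s + 4) * hpow (expo n s) = hpow (2 * n) / 4.
  rewrite (_ : (2 * s + 4)%N = (expo n s - (2 * n + 2))%N); last by rewrite /expo; lia.
  rewrite hpow_sub ?hpowD; last by rewrite /expo; lia.
  by rewrite !hpowS hpow0; lra.
have h3 : 2 ^+ (2 * n + s + 3) * hpow (expo n s) = hpow (s + 3).
  rewrite (_ : (2 * n + s + 3)%N = (expo n s - (s + 3))%N); last by rewrite /expo; lia.
  by rewrite hpow_sub // /expo; lia.
by rewrite -massE mulrBl mulrDl -[_ * hpow (expo n s)]mulrA h4 h3; lra.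
Qed.

Lemma numer0E n s : (numer0 n s)%:R * hpow (expo n s)
  = approx R n s / 4 + hpow (s + 3) - hpow (expo n s) + hpow (2 * s + 3).
Proof.
rewrite natrD mulrDl numerE natrX; congr (_ + _).
rewrite (_ : (2 * n + 3)%N = (expo n s - (2 * s + 3))%N); last by rewrite /expo; lia.
by rewrite hpow_sub // /expo; lia.
Qed.

Lemma upovm_approxE n w : let s := pickle w in herQ_val R (upovm_approx (n, w)) =
  kmx i0 i1 (approx R n s / 4 + hpow (s + 3) - hpow (expo n s))
      (hpow (2 * s + 3)) (hpow (s + 3)).
Proof.
move=> s; apply/matrixP => i j; rewrite !mxE /= -/s (rmorph0 (@ratr R)).
congr (Complex _ 0); case: ifP => _; last first.
  by case: ifP => _; rewrite ?ratr_dyadic ?mul1r ?rmorph0.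
by rewrite ratr_dyadic; case: ifP => _; rewrite ?numer0E ?numerE.
Qed.

Lemma rec_numer : rec2 numer.
Proof.
rewrite /rec2 /numer; apply: recP; apply: recD; last by rec_auto.
by apply: recM; [apply: (rec_comp2 rec_mass) |]; rec_auto.
Qed.

Lemma rec_pickle_dyadic n (m L : seq nat -> nat) : rec n m -> rec n L ->
  (forall xs, odd (m xs)) -> rec n (fun xs => pickle (dyadic (m xs) (L xs))).
Proof.
move=> Hm HL om; apply: (rec_ext (f := fun xs =>
  cns (pickle_posz (m xs)) (cns (pickle_posz (2 ^ L xs)) 0))).
  by rewrite /pickle_posz; rec_auto.
by move=> xs _; rewrite pickle_dyadic.
Qed.

Lemma upovm_approx_rec : total_recursive upovm_approx.
Proof.
(* The argument (n, w) arrives as one number, and the matrix depends on the string only through its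
   code, so no decoding to a string is required. *)
pose n xs := hd (nth 0%N xs 0); pose s xs := hd (tl (nth 0%N xs 0)).
pose A xs : 'M[rat]_N := \matrix_(i, j)
  (if i == j then dyadic (if i == i0 then numer0 (n xs) (s xs) else numer (n xs) (s xs))
                     (expo (n xs) (s xs))
   else if (i == i0) && (j == i1) || (i == i1) && (j == i0) then dyadic 1 (s xs + 3)
   else 0).
suff [c Hc] : rec 1 (fun xs => pickle (A xs, 0 : 'M[rat]_N)).
  exists c => -[k w]; have := Hc [:: pickle (k, w)] erefl.
  by rewrite /A /n /s pickle_pair /= tl_cns !hd_cns.
have Hn : rec 1 n by rewrite /n; rec_auto.
have Hs : rec 1 s by rewrite /s; rec_auto.
have HL : rec 1 (fun xs => expo (n xs) (s xs)) by rewrite /expo; rec_auto.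
have Hm : rec 1 (fun xs => numer (n xs) (s xs)) by apply: (rec_comp2 rec_numer).
apply: (rec_ext (f := fun xs => cns (pickle (A xs)) (cns (pickle (0 : 'M[rat]_N)) 0))) => //.
apply: reccns; last exact: rec_const.
apply: (rec_ext (f := fun xs =>
    CodeSeq.code [seq cns (pickle ij) (cns (pickle (A xs ij.1 ij.2)) 0)
                 | ij <- enum {: 'I_N * 'I_N}])); last by move=> xs _; rewrite pickle_mx.
apply: (rec_code (F := fun ij xs => cns (pickle ij) (cns (pickle (A xs ij.1 ij.2)) 0))).
move=> [i j]; apply: reccns; first exact: rec_const.
apply: reccns; last exact: rec_const.
apply: (rec_ext (f := fun xs => pickle
  (if i == j then dyadic (if i == i0 then numer0 (n xs) (s xs) else numer (n xs) (s xs))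
                     (expo (n xs) (s xs))
   else if (i == i0) && (j == i1) || (i == i1) && (j == i0) then dyadic 1 (s xs + 3)
   else 0))); last by move=> xs _; rewrite mxE.
case: (i == j).
  apply: rec_pickle_dyadic => // [|xs]; case: (i == i0) => //.
  - by apply: recD; rec_auto.
  - exact: odd_numer0.
  - exact: odd_numer.
case: (_ || _); last exact: rec_const.
by apply: rec_pickle_dyadic => //; [apply: rec_const | rec_auto].
Qed.

Lemma usm_ge0 s : 0 <= usm R s.
Proof. exact: le_trans (approx_ge0 R 0 s) (approx_le R 0 s). Qed.

Lemma hpow_mono j k : (j <= k)%N -> hpow k <= hpow j.
Proof.
by move=> le_jk; rewrite lef_pV2 ?posrE ?exprn_gt0 // ler_eXn2l // ltr1n.
Qed.

Lemma hpow_inj : injective hpow.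
Proof.
by move=> j k /invr_inj /eqP; rewrite -!natrX eqr_nat eqn_exp2l // => /eqP.
Qed.

Lemma hpow_cvg0 s : ((fun n => hpow (expo n s)) @ \oo --> (0 : R))%classic.
Proof.
have -> : (fun n => hpow (expo n s)) = (fun n => hpow (2 * s + 6) * (4^-1) ^+ n).
  apply/funext => n; rewrite /expo -addnA addnC hpowD; congr (_ * _).
  by rewrite /hpow exprM -exprVn; congr (_^-1 ^+ _); rewrite expr2; lra.
rewrite -[X in (_ --> X)%classic](mulr0 (hpow (2 * s + 6))).
apply: cvgM; [exact: cvg_cst | apply: cvg_expr].
by rewrite ger0_norm; lra.
Qed.

Lemma upovm_psd w : psd (upovm w).
Proof.
have := usm_ge0 (pickle w); have := hpow_gt0 R (pickle w + 3).
have := hpow_gt0 R (2 * pickle w + 3) => a0 b0 u0.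
by apply: kmx_psd => //; rewrite gtr0_norm //; lra.
Qed.

Lemma upovm_semiPOVM : semiPOVM upovm.
Proof.
split=> [w|l Ul]; first by rewrite /loewner_le subr0; apply: upovm_psd.
rewrite /loewner_le /upovm kmx_sum.
have -> : 1%:M = kmx i0 i1 1 0 0 :> 'M[C]_N by rewrite kmx_scalar.
rewrite kmxB !sub0r.
have hl : \sum_(w <- l) hpow (pickle w + 3) <= 4^-1.
  rewrite (eq_bigr (fun w => 4^-1 * hpow (pickle w).+1)); last first.
    by move=> w _; rewrite addn3 hpowS (hpowS _ (pickle w).+1); lra.
  rewrite -mulr_sumr ler_piMr ?invr_ge0 //.
  apply: (@sum_pickle_le1 R (fun s => hpow s.+1)) => // [s|T].
    by rewrite ltW ?hpow_gt0.
  exact: sum_hpow.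
have hu : \sum_(w <- l) usm R (pickle w) / 4 <= 4^-1.
  rewrite -mulr_suml ler_pdivrMr // mulVf ?pnatr_eq0 //.
  by apply: sum_pickle_le1 => // [s|T]; [apply: usm_ge0 | apply: sum_usm].
have ha : \sum_(w <- l) hpow (2 * pickle w + 3) <= \sum_(w <- l) hpow (pickle w + 3).
  by apply: ler_sum => w _; apply: hpow_mono; lia.
have h0 : 0 <= \sum_(w <- l) hpow (pickle w + 3).
  by apply: sumr_ge0 => w _; rewrite ltW ?hpow_gt0.
rewrite big_split /=.
(* The three coefficients sum to at most 1/2, 1/4 and 1/4, so the diagonal left in I is at least 1/4
   and dominates the off-diagonal part. *)
by apply: kmx_psd => //; rewrite normrN ger0_norm //; lra.
Qed.

Lemma upovm_lower_computable : lower_computable_semiPOVM upovm.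
Proof.
split; first exact: upovm_semiPOVM.
exists upovm_approx; split; first exact: upovm_approx_rec.
split=> [n w|]; first by rewrite upovm_approxE; apply: kmx_herm.
split=> [w i j|n w]; last first.
  (* Only the coefficient of I is approximated; the difference is a nonnegative multiple of I. *)
  rewrite /loewner_le upovm_approxE kmxB !subrr.
  have := approx_le R n (pickle w); have := hpow_gt0 R (expo n (pickle w)) => e0 le_a.
  by apply: kmx_psd => //; rewrite normr0; lra.
rewrite [upovm w i j]mxE; split; under eq_fun do rewrite upovm_approxE mxE /=;
  last exact: cvg_cst.
rewrite /=.
case: ifP => _; last by case: ifP => _; apply: cvg_cst.
set s := pickle w.
have H : ((fun n => approx R n s / 4 + hpow (s + 3) - hpow (expo n s)) @ \oo
    --> usm R s / 4 + hpow (s + 3))%classic.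
  rewrite -[X in (_ --> X)%classic]subr0; apply: cvgB; last exact: hpow_cvg0.
  by apply: cvgD; [apply: cvgM; [apply: approx_cvg|] |]; apply: cvg_cst.
by case: ifP => _ //; apply: cvgD => //; apply: cvg_cst.
Qed.

Lemma upovm_universal : universal_semiPOVM upovm.
Proof.
split=> [|P [P_povm [f [f_rec [_ [f_cvg f_le]]]]]]; first exact: upovm_lower_computable.
have [c c0 Hc] := usm_dominates P_povm f_rec f_cvg f_le.
(* The difference splits as (m(s) I - c P(w)) / 4 plus the added dyadic matrix, both positive
   semi-definite. *)
exists (c / 4); split=> [|w]; first by rewrite divr_gt0.
set s := pickle w.
have b0 := hpow_gt0 R (s + 3); have a0 := hpow_gt0 R (2 * s + 3).
have psd1 : psd (kmx i0 i1 (hpow (s + 3)) (hpow (2 * s + 3)) (hpow (s + 3)) : 'M[C]_N).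
  by apply: kmx_psd => //; rewrite gtr0_norm //; lra.
have psd2 : psd ((4^-1)%:C%C *: ((usm R s)%:C%C%:M - c%:C%C *: P w)).
  by apply: psdZ; [lra | apply: Hc].
have := psdD psd2 psd1; rewrite /loewner_le; congr psd.
rewrite scalerBr scalerA -rmorphM /= scale_scalar_mx -rmorphM /= -(kmx_scalar i0 i1) addrAC kmxD.
by rewrite !add0r [4^-1 * c]mulrC [4^-1 * usm _ _]mulrC.
Qed.

Lemma upovm_noncomm w x : w != x -> upovm w *m upovm x - upovm x *m upovm w != 0.
Proof.
move=> neq_wx; apply: kmx_noncomm => //; rewrite -!hpowD.
(* Equal products would give 2s + t = 2t + s for the codes s and t of the two strings, hence s =
   t. *)
apply: contraNneq neq_wx => /hpow_inj H; apply/eqP/(pcan_inj pickleK); lia.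
Qed.

End Universal.

Theorem mainTheorem4 (R : realType) (N : nat) (hN : (2 <= N)%N) :
  exists M : bstring -> 'M[R[i]]_N,
    universal_semiPOVM M /\
    forall s t : bstring, s != t -> M s *m M t - M t *m M s != 0.
Proof.
pose i0 := Ordinal (ltnW hN); pose i1 := Ordinal hN.
have neq01 : i0 != i1 by [].
exists (upovm R i0 i1); split; first exact: upovm_universal.
by move=> s t; apply: upovm_noncomm.
Qed.
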